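(* Let $V$ be a finite-dimensional Hilbert space, let $q,r\in\mathbb C^\times$ with $q^2\ne1$ and with $r^{-1},q,-q^{-1}$ pairwise distinct, and let $G\in\mathrm{End}(V\otimes V)$ satisfy the Yang--Baxter equation and $$(G-r^{-1}I)(G-qI)(G+q^{-1}I)=0.$$ Put $x=\frac{r-r^{-1}}{q-q^{-1}}+1$ and $E=I-\frac{G-G^{-1}}{q-q^{-1}}$. Suppose $x\ne0$ and $E=x\,|\psi\rangle\langle\psi|$ for a unit vector $\psi\in V\otimes V$, and suppose that, for both choices of sign, $$(\langle\psi|_{12}\otimes I)\,G_{23}^{\pm1}\,(|\psi\rangle_{12}\otimes I)=\frac{r^{\pm1}}{x}I$$ as operators on $V$. Then, for every $n\ge2$, the assignments $g_i\mapsto G_i$, $e_i\mapsto E_i$ ($1\le i<n$) extend to a representation $C_n(r,q)\to\mathrm{End}(V^{\otimes n})$ of the BMW algebra.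
   Context: The Yang--Baxter equation is $(G\otimes I)(I\otimes G)(G\otimes I)=(I\otimes G)(G\otimes I)(I\otimes G)$. $G_i,E_i$ are the local copies $I^{\otimes(i-1)}\otimes G\otimes I^{\otimes(n-i-1)}$ and $I^{\otimes(i-1)}\otimes E\otimes I^{\otimes(n-i-1)}$ on $V^{\otimes n}$. In the contraction, $|\psi\rangle_{12}\otimes I:V\to V^{\otimes3}$ is $v\mapsto\psi\otimes v$, $\langle\psi|_{12}\otimes I$ is its adjoint, and $G_{23}=I\otimes G$ on $V^{\otimes 3}$. $C_n(r,q)$ is the Birman--Murakami--Wenzl algebra: the unital complex algebra generated by invertible $g_1,\dots,g_{n-1}$ and elements $e_1,\dots,e_{n-1}$ with $g_ig_{i+1}g_i=g_{i+1}g_ig_{i+1}$, $g_ig_j=g_jg_i$ for $|i-j|>1$, $g_i-g_i^{-1}=(q-q^{-1})(1-e_i)$, $e_ig_i=r^{-1}e_i$, $e_ig_{i\pm1}^{\epsilon}e_i=r^{\epsilon}e_i$ for $\epsilon\in\{1,-1\}$ and either neighbor $i\pm1$; in it $e_i^2=xe_i$. *)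

(* Defs.v *)
From HB Require Import structures.
From mathcomp Require Import all_boot all_order all_algebra.
From mathcomp Require Import boolp reals.
From mathcomp Require Import complex mxtens.
From mathcomp Require Import monalg.

Set Implicit Arguments.
Unset Strict Implicit.
Unset Printing Implicit Defensive.

Import Order.TTheory GRing.Theory Num.Theory.
Local Open Scope ring_scope.
Local Open Scope quotient_scope.
Local Open Scope sesquilinear_scope.

(* Noncommutative polynomials: [{fmonom X}] is the monoid of words in X. *)
Definition free_alg (K : comNzRingType) (X : choiceType) : Type :=
  {malg K[{fmonom X}]}.

HB.instance Definition _ (K : comNzRingType) (X : choiceType) :=
  GRing.Lalgebra.on (free_alg K X).

(* Locked: unification otherwise unfolds the product of [{malg _}]. *)
HB.lock
Definition free_gen (K : comNzRingType) (X : choiceType) (x : X) :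
  free_alg K X := << fmu x >>.

Section Presentation.
Variables (K : comNzRingType) (X : choiceType).

Local Notation free_alg := (free_alg K X).
Local Notation free_gen := (@free_gen K X).

Lemma free_alg_scaleAr (c : K) (u v : free_alg) : c *: (u * v) = u * (c *: v).
Proof.
have comC w : w * c%:MP = c%:MP * w :> {malg K[{fmonom X}]}.
  rewrite malgM_def /= /fgmul.
  rewrite -[RHS]/(fgmul _ _) fgmulUg -/(fgmul _ _) fgmulgU.
  by apply: eq_bigr => k _; rewrite mulm1 mul1m mulrC.
by rewrite -!mul_malgC mulrA -comC -mulrA.
Qed.

Definition fmonom_eval (phi : X -> K) (m : {fmonom X}) : K :=
  \prod_(x <- m) phi x.

Lemma fmonom_eval_mmorphism (phi : X -> K) : mmorphism (fmonom_eval phi).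
Proof.
split=> [m1 m2|]; last by rewrite /fmonom_eval fm1 big_nil.
by rewrite /fmonom_eval fmM big_cat.
Qed.

HB.instance Definition _ (phi : X -> K) :=
  isMultiplicative.Build {fmonom X} K (fmonom_eval phi)
    (fmonom_eval_mmorphism phi).

Definition free_eval (phi : X -> K) : free_alg -> K :=
  mmap idfun (fmonom_eval phi).

HB.instance Definition _ phi := GRing.RMorphism.on (free_eval phi).

Lemma free_evalZ phi c u : free_eval phi (c *: u) = c * free_eval phi u.
Proof. exact: mmapZ. Qed.

Lemma free_eval_gen phi x : free_eval phi (free_gen x) = phi x.
Proof. by rewrite unlock /free_eval mmapU mul1r /fmonom_eval fmuE big_seq1. Qed.

Variable rel : free_alg -> free_alg -> Prop.

(* The two-sided ideal generated by the u - v with [rel u v]; it is stable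
   under scaling because c *: w = (c *: 1) * w * 1. *)
Inductive rel_ideal : free_alg -> Prop :=
| rel_ideal_gen u v : rel u v -> rel_ideal (u - v)
| rel_ideal0 : rel_ideal 0
| rel_idealB u v : rel_ideal u -> rel_ideal v -> rel_ideal (u - v)
| rel_idealM u w v : rel_ideal w -> rel_ideal (u * w * v).

Definition rel_ideal_pred : pred free_alg := fun u => `[< rel_ideal u >].

Lemma rel_idealP u : reflect (rel_ideal u) (u \in rel_ideal_pred).
Proof. exact: asboolP. Qed.

Lemma rel_ideal_zmod_closed : zmod_closed rel_ideal_pred.
Proof.
split=> [|u v /rel_idealP Iu /rel_idealP Iv]; apply/rel_idealP.
  exact: rel_ideal0.
exact: rel_idealB.
Qed.

HB.instance Definition _ :=
  GRing.isZmodClosed.Build free_alg rel_ideal_pred rel_ideal_zmod_closed.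

Definition rel_ideal_zmod : zmodClosed free_alg :=
  GRing.ZmodClosed.clone free_alg rel_ideal_pred _.

Definition presented : Type :=
  Quotient.quot rel_ideal_zmod.

HB.instance Definition _ := GRing.Zmodule.on presented.

Definition presented_pi (u : free_alg) : presented :=
  \pi_(Quotient.quot rel_ideal_zmod) u.

Local Notation pi := presented_pi.

Lemma presented_piP u v : reflect (pi u = pi v) (u - v \in rel_ideal_pred).
Proof. by rewrite Quotient.idealrBE; exact: eqP. Qed.

Definition presented_repr (a : presented) : free_alg :=
  repr (a : Quotient.quot rel_ideal_zmod).

Local Notation rep := presented_repr.

Lemma presented_reprK : cancel rep pi.
Proof. exact: reprK. Qed.

Lemma presented_pi_is_zmod : zmod_morphism pi.
Proof. by move=> u v; rewrite /pi /= !piE. Qed.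

HB.instance Definition _ :=
  GRing.isZmodMorphism.Build free_alg presented pi presented_pi_is_zmod.

Lemma presented_piD u v : pi (u + v) = pi u + pi v.
Proof. exact: raddfD. Qed.

Definition presented_one : presented := pi 1.
Definition presented_mul (a b : presented) : presented := pi (rep a * rep b).
Definition presented_scale (c : K) (a : presented) : presented := pi (c *: rep a).

Lemma presented_repr_piP u : rep (pi u) - u \in rel_ideal_pred.
Proof. by apply/presented_piP; exact: presented_reprK. Qed.

Lemma presented_piM u v : pi (u * v) = presented_mul (pi u) (pi v).
Proof.
apply/esym/presented_piP.
set u' := rep _; set v' := rep _.
have -> : u' * v' - u * v = 1 * (u' - u) * v' + u * (v' - v) * 1.
  by rewrite mul1r mulr1 mulrBl mulrBr addrA subrK.
by apply: rpredD; apply/rel_idealP/rel_idealM/rel_idealP;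
  exact: presented_repr_piP.
Qed.

Lemma presented_piZ c u : pi (c *: u) = presented_scale c (pi u).
Proof.
apply/esym/presented_piP/rel_idealP; rewrite -scalerBr.
have -> w : c *: w = (c *: 1) * w * 1 :> free_alg.
  by rewrite mulr1 -scalerAl mul1r.
by apply: rel_idealM; apply/rel_idealP; exact: presented_repr_piP.
Qed.

Local Ltac lift x := rewrite -(presented_reprK x); move: (rep x) => {}x.

Lemma presented_mulA : associative presented_mul.
Proof. by move=> a b c; lift a; lift b; lift c; rewrite -!presented_piM mulrA. Qed.

Lemma presented_mul1 : left_id presented_one presented_mul.
Proof. by move=> a; lift a; rewrite -!presented_piM mul1r. Qed.

Lemma presented_mulr1 : right_id presented_one presented_mul.
Proof. by move=> a; lift a; rewrite -!presented_piM mulr1. Qed.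

Lemma presented_mulDl : left_distributive presented_mul +%R.
Proof.
move=> a b c; lift a; lift b; lift c.
by rewrite -(presented_piD a b) -!presented_piM -presented_piD mulrDl.
Qed.

Lemma presented_mulDr : right_distributive presented_mul +%R.
Proof.
move=> a b c; lift a; lift b; lift c.
by rewrite -(presented_piD b c) -!presented_piM -presented_piD mulrDr.
Qed.

HB.instance Definition _ := GRing.Zmodule_isPzRing.Build presented
  presented_mulA presented_mul1 presented_mulr1 presented_mulDl presented_mulDr.

Lemma presented_scaleA c c' a :
  presented_scale c (presented_scale c' a) = presented_scale (c * c') a.
Proof. by lift a; rewrite -!presented_piZ scalerA. Qed.

Lemma presented_scale1 : left_id 1 presented_scale.
Proof. by move=> a; lift a; rewrite -!presented_piZ scale1r. Qed.

Lemma presented_scaleDr : right_distributive presented_scale +%R.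
Proof.
move=> c a b; lift a; lift b.
by rewrite -(presented_piD a b) -!presented_piZ -presented_piD scalerDr.
Qed.

Lemma presented_scaleDl a : {morph presented_scale^~ a : c c' / c + c'}.
Proof.
by move=> c c' /=; lift a; rewrite -!presented_piZ -presented_piD scalerDl.
Qed.

HB.instance Definition _ := GRing.Zmodule_isLmodule.Build K presented
  presented_scaleA presented_scale1 presented_scaleDr presented_scaleDl.

Lemma presented_pi_is_monoid : monoid_morphism pi.
Proof. by split; [exact: erefl | exact: presented_piM]. Qed.

HB.instance Definition _ :=
  GRing.isMonoidMorphism.Build free_alg presented pi presented_pi_is_monoid.

Lemma presented_pi_is_scalable : scalable pi.
Proof. exact: presented_piZ. Qed.

HB.instance Definition _ :=
  GRing.isScalable.Build K free_alg presented *:%R pi presented_pi_is_scalable.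

Lemma presented_scaleAl c (a b : presented) : c *: (a * b) = (c *: a) * b.
Proof.
lift a; lift b; rewrite -[c *: pi a]presented_piZ -[_ * _]presented_piM.
by rewrite -[_ * pi b]presented_piM -[LHS]presented_piZ scalerAl.
Qed.

Lemma presented_scaleAr c (a b : presented) : c *: (a * b) = a * (c *: b).
Proof.
lift a; lift b; rewrite -[c *: pi b]presented_piZ -[pi a * pi b]presented_piM.
by rewrite -[RHS]presented_piM -[LHS]presented_piZ free_alg_scaleAr.
Qed.

Lemma presented_oner_neq0 (phi : X -> K) :
  (forall u v, rel u v -> free_eval phi u = free_eval phi v) ->
  1 != 0 :> presented.
Proof.
move=> phi_rel; apply/eqP; rewrite -(rmorph1 pi) -(rmorph0 pi).
move=> /presented_piP/rel_idealP.
have ker u : rel_ideal u -> free_eval phi u = 0.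
  elim=> {u} [u v uv||u v _ u0 _ v0|u w v _ w0].
  - by rewrite rmorphB /= (phi_rel _ _ uv) subrr.
  - exact: rmorph0.
  - by rewrite rmorphB /= u0 v0 subrr.
  - by rewrite !rmorphM /= w0 mulr0 mul0r.
by rewrite subr0 => /ker; rewrite rmorph1 => /eqP; rewrite oner_eq0.
Qed.

End Presentation.

(* The index i : 'I_n.-1 stands for the generators numbered i+1 in the usual
   1, ..., n-1 convention. *)
Variant bmw_gen (n : nat) : Type :=
| BmwG of 'I_n.-1
| BmwGinv of 'I_n.-1
| BmwE of 'I_n.-1.

Arguments BmwG {n}.
Arguments BmwGinv {n}.
Arguments BmwE {n}.

Section BmwGenChoice.
Variable n : nat.

Definition bmw_gen_encode (x : bmw_gen n) : 'I_n.-1 + 'I_n.-1 + 'I_n.-1 :=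
  match x with
  | BmwG i => inl (inl i)
  | BmwGinv i => inl (inr i)
  | BmwE i => inr i
  end.

Definition bmw_gen_decode (s : 'I_n.-1 + 'I_n.-1 + 'I_n.-1) : bmw_gen n :=
  match s with
  | inl (inl i) => BmwG i
  | inl (inr i) => BmwGinv i
  | inr i => BmwE i
  end.

Lemma bmw_gen_encodeK : cancel bmw_gen_encode bmw_gen_decode.
Proof. by case. Qed.

HB.instance Definition _ := Choice.copy (bmw_gen n) (can_type bmw_gen_encodeK).

End BmwGenChoice.

Section BMW.
Variables (K : fieldType) (n : nat) (r q : K).

Local Notation F := (free_alg K (bmw_gen n)).
Local Notation fg i := (free_gen K (BmwG i)).
Local Notation fg' i := (free_gen K (BmwGinv i)).
Local Notation fe i := (free_gen K (BmwE i)).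

Definition adjacent (i j : 'I_n.-1) : bool :=
  (j == i.+1 :> nat) || (i == j.+1 :> nat).

Definition distant (i j : 'I_n.-1) : bool := (i.+1 < j)%N || (j.+1 < i)%N.

(* e_i ^ 2 = x e_i is not imposed: it follows from the skein relation and
   e_i g_i = r^-1 e_i once q ^ 2 != 1. *)
Inductive bmw_rel : F -> F -> Prop :=
| bmw_rel_mulgV i : bmw_rel (fg i * fg' i) 1
| bmw_rel_mulVg i : bmw_rel (fg' i * fg i) 1
| bmw_rel_braid (i j : 'I_n.-1) : j = i.+1 :> nat ->
    bmw_rel (fg i * fg j * fg i) (fg j * fg i * fg j)
| bmw_rel_comm i j : distant i j -> bmw_rel (fg i * fg j) (fg j * fg i)
| bmw_rel_skein i : bmw_rel (fg i - fg' i) ((q - q^-1) *: (1 - fe i))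
| bmw_rel_eg i : bmw_rel (fe i * fg i) (r^-1 *: fe i)
| bmw_rel_ege i j : adjacent i j ->
    bmw_rel (fe i * fg j * fe i) (r *: fe i)
| bmw_rel_egVe i j : adjacent i j ->
    bmw_rel (fe i * fg' j * fe i) (r^-1 *: fe i).

Definition bmw : Type := presented bmw_rel.

HB.instance Definition _ := GRing.PzRing.on bmw.
HB.instance Definition _ := GRing.Lmodule.on bmw.

(* The algebra is nonzero: g_i |-> q, e_i |-> 0 is a character (with q
   replaced by 1 if q = 0, where q^-1 = 0). *)
Lemma bmw_oner_neq0 : 1 != 0 :> bmw.
Proof.
pose c := if q == 0 then 1 else q.
have c0 : c != 0 by rewrite /c; case: ifPn => // _; exact: oner_neq0.
have cq : c - c^-1 = q - q^-1.
  by rewrite /c; case: ifPn => // /eqP ->; rewrite invr1 invr0 !subrr.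
pose phi (x : bmw_gen n) :=
  match x with BmwG _ => c | BmwGinv _ => c^-1 | BmwE _ => 0 end.
pose ev := free_eval phi.
have evD u v : ev (u - v) = ev u - ev v by exact: rmorphB.
have evM u v : ev (u * v) = ev u * ev v by exact: rmorphM.
have evM3 u v w : ev (u * v * w) = ev u * ev v * ev w by rewrite [LHS]evM evM.
have evZ a u : ev (a *: u) = a * ev u by exact: free_evalZ.
have ev1 : ev 1 = 1 by exact: rmorph1.
have evg i : ev (fg i) = c by exact: free_eval_gen.
have evg' i : ev (fg' i) = c^-1 by exact: free_eval_gen.
have eve i : ev (fe i) = 0 by exact: free_eval_gen.
apply: (@presented_oner_neq0 _ _ _ phi) => u v; rewrite -/(ev u) -/(ev v).
move: ev evD evM evM3 evZ ev1 evg evg' eve.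
move=> ev evD evM evM3 evZ ev1 evg evg' eve.
case=> [i|i|i j _|i j _|i|i|i j _|i j _].
- by rewrite evM evg evg' ev1 mulfV.
- by rewrite evM evg evg' ev1 mulVf.
- by rewrite [LHS]evM3 [RHS]evM3 !evg.
- by rewrite [LHS]evM [RHS]evM !evg.
- by rewrite evZ !evD evg evg' ev1 eve subr0 mulr1.
- by rewrite [LHS]evM [RHS]evZ eve mul0r mulr0.
- by rewrite [LHS]evM [RHS]evZ eve !mulr0.
- by rewrite [LHS]evM [RHS]evZ eve !mulr0.
Qed.

HB.instance Definition _ := GRing.PzSemiRing_isNonZero.Build bmw bmw_oner_neq0.
HB.instance Definition _ := GRing.Lmodule_isLalgebra.Build K bmw
  (@presented_scaleAl _ _ bmw_rel).
HB.instance Definition _ := GRing.Lalgebra_isAlgebra.Build K bmw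
  (@presented_scaleAr _ _ bmw_rel).

Definition bmw_of_gen (x : bmw_gen n) : bmw :=
  presented_pi bmw_rel (free_gen K x).

Definition bmw_g (i : 'I_n.-1) : bmw := bmw_of_gen (BmwG i).
Definition bmw_e (i : 'I_n.-1) : bmw := bmw_of_gen (BmwE i).

End BMW.

Arguments bmw_g {K n r q} i.
Arguments bmw_e {K n r q} i.

(* V is C^d with its standard inner product, and V^{\otimes n} is C^(d ^ n)
   through the Kronecker product [*t]. *)
Section TensorPowers.
Variables (C : numClosedFieldType) (d : nat).

Lemma local_copy_dim n (i : 'I_n.-1) :
  (d ^ i * (d * d) * d ^ (n - i.+2) = d ^ n)%N.
Proof.
have lt_in : (i.+2 <= n)%N by case: n i => [|[|n]] // [].
by rewrite mulnn -!expnD addn2 subnKC.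
Qed.

(* I^{\otimes i} \otimes A \otimes I^{\otimes (n-i-2)}, with i counted from 0. *)
Definition local_copy n (A : 'M[C]_(d * d)) (i : 'I_n.-1) : 'M[C]_(d ^ n) :=
  castmx (local_copy_dim i, local_copy_dim i)
    ((1%:M : 'M_(d ^ i)) *t A *t (1%:M : 'M_(d ^ (n - i.+2)))).

Definition op12 (A : 'M[C]_(d * d)) : 'M[C]_(d * d * d) :=
  A *t (1%:M : 'M_d).

Definition op23 (A : 'M[C]_(d * d)) : 'M[C]_(d * d * d) :=
  castmx (mulnA d d d, mulnA d d d) ((1%:M : 'M_d) *t A).

Definition yang_baxter (G : 'M[C]_(d * d)) : Prop :=
  op12 G *m op23 G *m op12 G = op23 G *m op12 G *m op23 G.

Definition ket12 (psi : 'cV[C]_(d * d)) : 'M[C]_(d * d * d, d) :=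
  castmx (erefl _, mul1n d) (psi *t (1%:M : 'M_d)).

Definition bra12 (psi : 'cV[C]_(d * d)) : 'M[C]_(d, d * d * d) :=
  (ket12 psi)^t*.

End TensorPowers.

(* Main.v *)
From HB Require Import structures.
Require Import Defs.
From mathcomp Require Import all_boot all_order all_algebra.
From mathcomp Require Import reals complex mxtens monalg zify.

Set Implicit Arguments.
Unset Strict Implicit.
Unset Printing Implicit Defensive.

Import Order.TTheory GRing.Theory Num.Theory.
Local Open Scope ring_scope.
Local Open Scope sesquilinear_scope.

(* With e = 1 - (g - g^-1) / (q - q^-1), the cubic relation reads
   (g - r^-1) g e = 0, which gives e g = r^-1 e. Since E is x |psi><psi|, the
   contractions of G^{+-1} along psi give E_1 G_2^{+-1} E_1 = r^{+-1} E_1 on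
   V^{\otimes 3}. The other neighbour relation is not assumed but follows by
   conjugation: w = g_1 g_2 carries e_1 to e_2 and g_1 g_2 g_1^-1 to g_1, and
   e_1 (g_1 g_2 g_1^-1) e_1 = (r^-1 e_1) g_2 (r e_1) = r e_1. Finally, all the
   relations are transported from V^{\otimes 2} and V^{\otimes 3} to
   V^{\otimes n} by the algebra morphisms A |-> I \otimes A \otimes I. *)

(** * Universal property of an algebra given by generators and relations *)

Section PresentedLift.
Variables (K : comNzRingType) (X : choiceType) (A : algType K) (phi : X -> A).

Definition fmonom_map (m : {fmonom X}) : A := \prod_(x <- m) phi x.

Lemma fmonom_map_mmorphism : mmorphism fmonom_map.
Proof.
split=> [m1 m2|]; last by rewrite /fmonom_map fm1 big_nil.
by rewrite /fmonom_map fmM big_cat.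
Qed.

HB.instance Definition _ :=
  isMultiplicative.Build {fmonom X} A fmonom_map fmonom_map_mmorphism.

Definition free_lift : free_alg K X -> A := mmap (in_alg A) fmonom_map.

Lemma free_liftB u v : free_lift (u - v) = free_lift u - free_lift v.
Proof. exact: mmapB. Qed.

Lemma free_liftZ c u : free_lift (c *: u) = c *: free_lift u.
Proof. by rewrite [LHS]mmapZ /= mulr_algl. Qed.

(** Scalars are central in [A], so coefficients commute with images of words; this is the condition
    under which [mmap] into a noncommutative ring is multiplicative. *)
Lemma free_lift_monoid : monoid_morphism free_lift.
Proof.
have comm_alg (g : free_alg K X) m m' :
    GRing.comm (in_alg A g@_m) (fmonom_map m').
  by rewrite /GRing.comm /= mulr_algl mulr_algr.
by split; case: (commr_mmap_is_multiplicative comm_alg).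
Qed.

Lemma free_lift_gen x : free_lift (free_gen K x) = phi x.
Proof.
by rewrite unlock /free_lift mmapU /= scale1r mul1r /fmonom_map fmuE big_seq1.
Qed.

Variable rel : free_alg K X -> free_alg K X -> Prop.
Hypothesis phi_rel : forall u v, rel u v -> free_lift u = free_lift v.

Lemma free_lift_ideal u : rel_ideal rel u -> free_lift u = 0.
Proof.
have [lift1 liftM] := free_lift_monoid.
elim=> {u} [u v uv||u v _ u0 _ v0|u w v _ w0].
- by rewrite free_liftB (phi_rel uv) subrr.
- exact: mmap0.
- by rewrite free_liftB u0 v0 subrr.
- by rewrite !liftM w0 mulr0 mul0r.
Qed.

(** Evaluates a chosen representative; independence of the choice is [presented_lift_pi], which
    rests on [phi_rel]. *)
Definition presented_lift (a : presented rel) : A :=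
  free_lift (presented_repr a).

Lemma presented_lift_pi u : presented_lift (presented_pi rel u) = free_lift u.
Proof.
apply/eqP; rewrite -subr_eq0 -free_liftB; apply/eqP/free_lift_ideal.
exact/rel_idealP/presented_repr_piP.
Qed.

End PresentedLift.

(** * From the right-neighbour relations to the left-neighbour ones *)

Section Transfer.
Variables (K : fieldType) (A : algType K) (r c : K) (g1 g1' g2 g2' : A).
Let e1 := 1 - c *: (g1 - g1').
Let e2 := 1 - c *: (g2 - g2').
Hypotheses (r_neq0 : r != 0) (g1V : g1 * g1' = 1) (Vg1 : g1' * g1 = 1).
Hypotheses (g2V : g2 * g2' = 1) (Vg2 : g2' * g2 = 1).
Hypothesis braid : g1 * g2 * g1 = g2 * g1 * g2.
Hypothesis e1g1 : e1 * g1 = r^-1 *: e1.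

Lemma skein_comm : g1 * e1 = e1 * g1.
Proof.
by rewrite /e1 mulrBl mulrBr -scalerAl -scalerAr mulrBl mulrBr g1V Vg1 mulr1 mul1r.
Qed.

(** Since [e1] commutes with [g1], the eigenvalue relation also holds on the left,
    [g1 * e1 = r^-1 *: e1], and can be inverted. *)
Lemma skein_mulV : g1' * e1 = r *: e1.
Proof.
have g1e1 : g1 * e1 = r^-1 *: e1 by rewrite skein_comm.
rewrite -[RHS]mul1r -Vg1 -mulrA -scalerAr g1e1.
by rewrite scalerA mulfV // scale1r.
Qed.

Let w := g1 * g2.

Lemma braid_conj : g2 * w = w * g1.
Proof. by rewrite /w mulrA braid. Qed.

Lemma braid_conjV : g2' * w = w * g1'.
Proof.
by rewrite -[LHS]mulr1 -g1V mulrA -(mulrA g2') -braid_conj (mulrA g2') Vg2 mul1r.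
Qed.

Lemma skein_conj : e2 * w = w * e1.
Proof.
rewrite /e1 /e2 mulrBl mulrBr -scalerAl -scalerAr mulrBl mulrBr.
by rewrite braid_conj braid_conjV mul1r mulr1.
Qed.

(** Conjugation by [w] turns [e2 * a * e2] into [e1 * (g1 * b * g1') * e1]. There [e1] absorbs [g1]
    with factor r^-1 and [g1'] with factor r, and the two factors cancel. *)
Lemma skein_transfer (s : K) (a b : A) : a * w = w * (g1 * b * g1') ->
  e1 * b * e1 = s *: e1 -> e2 * a * e2 = s *: e2.
Proof.
move=> aw e1b.
(* A right inverse of [w] is enough: it reduces the claim to its product with [w] on the right. *)
have wV : w * (g2' * g1') = 1 by rewrite /w -mulrA [g2 * _]mulrA g2V mul1r.
have e1_conj : e1 * (g1 * b * g1') * e1 = s *: e1.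
  rewrite -(mulrA e1) -(mulrA _ g1') skein_mulV 2!(mulrA e1) e1g1 -scalerAr.
  by rewrite -!scalerAl scalerA mulfV // scale1r e1b.
rewrite -[LHS]mulr1 -[RHS]mulr1 -wV !(mulrA _ w); congr (_ * _).
rewrite -(mulrA _ e2) skein_conj (mulrA _ w) -(mulrA e2 a) aw (mulrA e2 w).
by rewrite skein_conj -(mulrA w e1) -(mulrA w) e1_conj -scalerAr -skein_conj scalerAl.
Qed.

(** Transfer with a = g1 and b = g2: the braid relation gives g2 g1 g2 g1' = g1 g2. *)
Lemma skein_left_neighbor :
  e1 * g2 * e1 = r *: e1 -> e2 * g1 * e2 = r *: e2.
Proof.
apply: skein_transfer; rewrite /w !mulrA -[RHS]mulrA.
by rewrite -!mulrA (mulrA g2 g1) (mulrA (g2 * g1)) -braid -!mulrA g1V mulr1.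
Qed.

(** Transfer with a = g1' and b = g2': both sides of the conjugation identity reduce to [g2]. *)
Lemma skein_left_neighborV :
  e1 * g2' * e1 = r^-1 *: e1 -> e2 * g1' * e2 = r^-1 *: e2.
Proof.
apply: skein_transfer; rewrite /w !mulrA Vg1 mul1r braid.
by rewrite -(mulrA _ g2) g2V mulr1 -mulrA g1V mulr1.
Qed.

End Transfer.

(** * Criterion for a representation of the BMW algebra *)

Section BmwRepresentation.
Variables (K : fieldType) (n : nat) (r q : K).

(** When q - q^-1 is nonzero, the skein relation forces this image of e_i. *)
Definition bmw_images (A : algType K) (g g' : 'I_n.-1 -> A)
  (x : bmw_gen n) : A :=
  match x with
  | BmwG i => g i
  | BmwGinv i => g' i
  | BmwE i => 1 - (q - q^-1)^-1 *: (g i - g' i)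
  end.

Lemma bmw_representation (A : algType K) (g g' : 'I_n.-1 -> A)
    (e := fun i => 1 - (q - q^-1)^-1 *: (g i - g' i)) :
    r != 0 -> q - q^-1 != 0 ->
    (forall i, g i * g' i = 1) -> (forall i, g' i * g i = 1) ->
    (forall i j : 'I_n.-1, j = i.+1 :> nat ->
      g i * g j * g i = g j * g i * g j) ->
    (forall i j, distant i j -> g i * g j = g j * g i) ->
    (forall i, e i * g i = r^-1 *: e i) ->
    (forall i j : 'I_n.-1, j = i.+1 :> nat -> e i * g j * e i = r *: e i) ->
    (forall i j : 'I_n.-1, j = i.+1 :> nat -> e i * g' j * e i = r^-1 *: e i) ->
  exists rho : {rmorphism bmw n r q -> A},
    [/\ scalable rho, forall i, rho (bmw_g i) = g i
      & forall i, rho (bmw_e i) = e i].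
Proof.
move=> r0 q0 gV Vg braid comm eg ege egVe.
pose phi := bmw_images g g'.
pose ev := free_lift phi.
have [ev1 evM] : monoid_morphism ev := free_lift_monoid phi.
have evB u v : ev (u - v) = ev u - ev v := free_liftB phi u v.
have evZ a u : ev (a *: u) = a *: ev u := free_liftZ phi a u.
have evg i : ev (free_gen K (BmwG i)) = g i := free_lift_gen phi _.
have evg' i : ev (free_gen K (BmwGinv i)) = g' i := free_lift_gen phi _.
have eve i : ev (free_gen K (BmwE i)) = e i := free_lift_gen phi _.
have phi_rel u v : bmw_rel r q u v -> ev u = ev v.
  case=> [i|i|i j ij|i j ij|i|i|i j|i j].
  - by rewrite evM evg evg' ev1.
  - by rewrite evM evg evg' ev1.
  - by rewrite !evM !evg braid.
  - by rewrite !evM !evg comm.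
  - by rewrite evZ !evB evg evg' ev1 eve /e subKr scalerA mulfV ?scale1r.
  - by rewrite evM evZ eve evg eg.
  - rewrite !evM evZ eve evg => /orP[]/eqP ij; first exact: ege.
    (* Here i = j + 1, so j takes the role of the first strand in the transfer. *)
    apply: (@skein_left_neighbor _ _ r _ (g j) (g' j)) => //.
    - exact: braid.
    - exact: eg.
    - exact: ege.
  - rewrite !evM evZ eve evg' => /orP[]/eqP ij; first exact: egVe.
    apply: (@skein_left_neighborV _ _ r _ (g j) (g' j)) => //.
    - exact: braid.
    - exact: eg.
    - exact: egVe.
pose lift : bmw n r q -> A := @presented_lift _ _ _ phi (@bmw_rel K n r q).
have lift_pi u : lift (presented_pi _ u) = ev u := presented_lift_pi phi_rel u.
(* Surjectivity of the projection reduces the morphism laws of [lift] to those of [ev]. *)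
have onto (a : bmw n r q) : exists u, a = presented_pi _ u.
  by exists (presented_repr a); rewrite presented_reprK.
have lift_zmod : zmod_morphism lift.
  by move=> a b; have [u ->] := onto a; have [v ->] := onto b;
     rewrite -[_ - _]raddfB !lift_pi evB.
have lift_monoid : monoid_morphism lift.
  split=> [|a b]; first by rewrite -ev1 -lift_pi.
  by have [u ->] := onto a; have [v ->] := onto b;
     rewrite -[_ * _]rmorphM !lift_pi evM.
pose rho : {rmorphism bmw n r q -> A} := HB.pack lift
  (GRing.isZmodMorphism.Build _ _ lift lift_zmod)
  (GRing.isMonoidMorphism.Build _ _ lift lift_monoid).
exists rho; split=> [c a|i|i] /=; last 2 first.
- exact: etrans (lift_pi _) (evg i).
- exact: etrans (lift_pi _) (eve i).
by have [u ->] := onto a; rewrite -[_ *: _]linearZ !lift_pi evZ.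
Qed.

End BmwRepresentation.

(** An [algType] is a nonzero ring, so the criterion applies to matrices only once the size has the
    form [N.+1]. *)
Lemma bmw_matrix_representation (K : fieldType) (n N : nat) (r q : K)
    (g g' : 'I_n.-1 -> 'M[K]_N)
    (e := fun i => 1%:M - (q - q^-1)^-1 *: (g i - g' i)) :
    (0 < N)%N -> r != 0 -> q - q^-1 != 0 ->
    (forall i, g i *m g' i = 1%:M) -> (forall i, g' i *m g i = 1%:M) ->
    (forall i j : 'I_n.-1, j = i.+1 :> nat ->
      g i *m g j *m g i = g j *m g i *m g j) ->
    (forall i j : 'I_n.-1, (i.+1 < j)%N -> g i *m g j = g j *m g i) ->
    (forall i, e i *m g i = r^-1 *: e i) ->
    (forall i j : 'I_n.-1, j = i.+1 :> nat -> e i *m g j *m e i = r *: e i) ->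
    (forall i j : 'I_n.-1, j = i.+1 :> nat ->
      e i *m g' j *m e i = r^-1 *: e i) ->
  exists rho : {rmorphism bmw n r q -> 'M[K]_N},
    [/\ scalable rho, forall i, rho (bmw_g i) = g i
      & forall i, rho (bmw_e i) = e i].
Proof.
case: N g g' @e => // N g g' e _ r0 q0 gV Vg braid comm eg ege egVe.
apply: (@bmw_representation _ _ _ _ 'M[K]_N.+1 g g') => // i j /orP[ij|ji].
  exact: comm.
exact/esym/comm.
Qed.

(** * Operators on tensor factors, up to dimension casts *)

Section Embedding.
Variable C : numClosedFieldType.

(** Common form of [local_copy], [op12] and [op23]; the dimension equation is a parameter so that
    any proof of it fits. *)
Definition embed_mx a b c N (eN : (a * b * c)%N = N) (A : 'M[C]_b) : 'M[C]_N :=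
  castmx (eN, eN) ((1%:M : 'M_a) *t A *t (1%:M : 'M_c)).

(** Both bracketings of a triple of indices encode the same number, so the cast only changes the
    type. *)
Lemma tensmxA m n p m' n' p' (A : 'M[C]_(m, m')) (B : 'M[C]_(n, n'))
    (D : 'M[C]_(p, p')) :
  A *t (B *t D) =
  castmx (esym (mulnA m n p), esym (mulnA m' n' p')) (A *t B *t D).
Proof.
apply/matrixP => i j.
case: (mxtens_indexP i) => i1 i23; case: (mxtens_indexP i23) => i2 i3.
case: (mxtens_indexP j) => j1 j23; case: (mxtens_indexP j23) => j2 j3.
rewrite castmxE !esymK.
have castE k l s (u : 'I_k) (v : 'I_l) (w : 'I_s) :
    cast_ord (mulnA k l s) (mxtens_index (u, mxtens_index (v, w))) =
    mxtens_index (mxtens_index (u, v), w).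
  by apply: val_inj => /=; rewrite mulnDl -mulnA addnA.
by rewrite !castE !tensmxE mulrA.
Qed.

Lemma tensmx1 m n : (1%:M : 'M[C]_m) *t (1%:M : 'M_n) = 1%:M.
Proof.
apply/matrixP => i j.
case: (mxtens_indexP i) => i1 i2; case: (mxtens_indexP j) => j1 j2.
rewrite tensmxE !mxE -natrM mulnb; congr (_%:R); congr nat_of_bool.
apply/andP/eqP => [[/eqP -> /eqP ->] // | /(congr1 (@mxtens_unindex m n))].
by rewrite !mxtens_indexK => -[-> ->].
Qed.

Lemma castmx1 m n (e : m = n) : castmx (e, e) (1%:M : 'M[C]_m) = 1%:M.
Proof. by case: n / e. Qed.

Lemma castmx_mulmx m n (e : m = n) (A B : 'M[C]_m) :
  castmx (e, e) (A *m B) = castmx (e, e) A *m castmx (e, e) B.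
Proof. by case: n / e. Qed.

Lemma castmx_irr m n m' n' (e e' : (m = m') * (n = n')) (A : 'M[C]_(m, n)) :
  castmx e A = castmx e' A.
Proof.
by case: e e' => [? ?] [? ?]; congr castmx; congr pair; exact: nat_irrelevance.
Qed.

Lemma tensmx_castl m n m' n' p s (e : (m = m') * (n = n')) (A : 'M[C]_(m, n))
    (B : 'M[C]_(p, s)) :
  castmx e A *t B =
  castmx (congr1 (muln^~ p) e.1, congr1 (muln^~ s) e.2) (A *t B).
Proof.
by case: e => /= e1 e2; case: m' / e1; case: n' / e2; rewrite !castmx_id.
Qed.

Lemma tensmx_castr m n m' n' p s (e : (m = m') * (n = n')) (A : 'M[C]_(m, n))
    (B : 'M[C]_(p, s)) :
  B *t castmx e A =
  castmx (congr1 (muln p) e.1, congr1 (muln s) e.2) (B *t A).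
Proof.
by case: e => /= e1 e2; case: m' / e1; case: n' / e2; rewrite !castmx_id.
Qed.

Section EmbedMorphism.
Variables (a b c N : nat) (eN : (a * b * c)%N = N).
Local Notation emb := (embed_mx eN).

Lemma embed_mx1 : emb 1%:M = 1%:M.
Proof. by rewrite /embed_mx !tensmx1 castmx1. Qed.

Lemma embed_mxM A B : emb (A *m B) = emb A *m emb B.
Proof. by rewrite /embed_mx -castmx_mulmx !tensmx_mul !mulmx1. Qed.

Lemma embed_mxB A B : emb (A - B) = emb A - emb B.
Proof.
by apply/matrixP => i j; rewrite !(castmxE, mxE) mulrBr mulrBl.
Qed.

Lemma embed_mxZ k A : emb (k *: A) = k *: emb A.
Proof.
by apply/matrixP => i j; rewrite !(castmxE, mxE) !mulrA [_ * k]mulrC.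
Qed.

End EmbedMorphism.

(** Adjacent identity factors merge. Once all casts are moved outside, the two sides differ only in
    proofs of equations between naturals, which are irrelevant. *)
Lemma embed_mx_comp a b c N a' b' c' a'' c'' (e : (a * b * c)%N = N)
    (e' : (a' * b' * c')%N = b) (e'' : (a'' * b' * c'')%N = N)
    (A : 'M[C]_b') : (a * a')%N = a'' -> (c' * c)%N = c'' ->
  embed_mx e (embed_mx e' A) = embed_mx e'' A.
Proof.
move=> ea ec; case: a'' / ea in e'' *; case: c'' / ec in e'' *; rewrite /embed_mx.
rewrite tensmx_castr tensmx_castl castmx_comp -!tensmx1.
rewrite !tensmxA !(tensmx_castl, tensmx_castr, castmx_comp).
exact: castmx_irr.
Qed.

Lemma tens1_mx m n (A : 'M[C]_(m, n)) :
  (1%:M : 'M_1) *t A = castmx (esym (mul1n m), esym (mul1n n)) A.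
Proof. by rewrite tens_scalar_mx scale1r. Qed.

Lemma tensmx_1 m n (A : 'M[C]_(m, n)) :
  A *t (1%:M : 'M_1) = castmx (esym (muln1 m), esym (muln1 n)) A.
Proof. by rewrite tens_mx_scalar scale1r. Qed.

(** [B] lies inside the right factor of dimension c, on which the embedding of [A] is the identity;
    m is the dimension of the gap between them. *)
Lemma embed_mx_comm a b m b' c' c a' N (e : (a * b * c)%N = N)
    (e' : (a' * b' * c')%N = N) (A : 'M[C]_b) (B : 'M[C]_b') :
    (a * b * m)%N = a' -> (m * b' * c')%N = c ->
  embed_mx e A *m embed_mx e' B = embed_mx e' B *m embed_mx e A.
Proof.
move=> ea ec; have e1 : (a * b * c * 1)%N = N by rewrite muln1.
rewrite -(embed_mx_comp e1 ec e' B ea (muln1 c')).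
have -> Z : embed_mx e1 Z = castmx (e, e) (1%:M *t Z).
  by rewrite /embed_mx tensmx_1 castmx_comp; exact: castmx_irr.
rewrite /embed_mx -!castmx_mulmx -(tensmx1 a) !tensmx_mul.
by rewrite !mulmx1 !mul1mx.
Qed.

Variable d : nat.

Lemma op12_embed (e : (1 * (d * d) * d)%N = (d * d * d)%N) (A : 'M[C]_(d * d)) :
  op12 A = embed_mx e A.
Proof.
by rewrite /embed_mx tens1_mx tensmx_castl castmx_comp (castmx_irr _ (erefl, erefl)).
Qed.

Lemma op23_embed (e : (d * (d * d) * 1)%N = (d * d * d)%N) (A : 'M[C]_(d * d)) :
  op23 A = embed_mx e A.
Proof.
by rewrite /embed_mx tensmx_1 castmx_comp; apply: castmx_irr.
Qed.

Lemma castmx_mul_adj m n p (e : n = p) (A : 'M[C]_(m, n)) :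
  castmx (erefl m, e) A *m (castmx (erefl m, e) A)^t* = A *m A^t*.
Proof. by case: p / e; rewrite castmx_id. Qed.

Lemma ket12_bra12 (psi : 'cV[C]_(d * d)) :
  ket12 psi *m bra12 psi = op12 (psi *m psi^t*).
Proof.
rewrite /bra12 /ket12 castmx_mul_adj trmx_tens map_mxT trmx1 map_mx1.
by rewrite tensmx_mul mulmx1.
Qed.

Section LocalCopies.
Variables (n : nat) (A B : 'M[C]_(d * d)).

Lemma local_copyM (i : 'I_n.-1) :
  local_copy (A *m B) i = local_copy A i *m local_copy B i.
Proof. exact: embed_mxM. Qed.

Lemma local_copy_comm (i j : 'I_n.-1) : (i.+1 < j)%N ->
  local_copy A i *m local_copy B j = local_copy B j *m local_copy A i.
Proof.
move=> ij; apply: (@embed_mx_comm _ _ (d ^ (j - i.+2))).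
  by rewrite mulnn -!expnD addn2 subnKC.
have lt_jn : (j.+2 <= n)%N by case: (n) (j) => [|[|k]] // [].
by rewrite mulnn -!expnD; congr (d ^ _)%N; lia.
Qed.

(** A single embedding serves both copies, so an identity mixing [op12] and [op23] can be
    transported as a whole. *)
Lemma local_copy_pair (i j : 'I_n.-1) : j = i.+1 :> nat ->
  exists e : (d ^ i * (d * d * d) * d ^ (n - i.+3) = d ^ n)%N,
    forall D, embed_mx e (op12 D) = local_copy D i /\
              embed_mx e (op23 D) = local_copy D j.
Proof.
move=> ij; have lt_in : (i.+3 <= n)%N.
  by rewrite -ij; case: (n) (j) => [|[|k]] // [].
have e : (d ^ i * (d * d * d) * d ^ (n - i.+3) = d ^ n)%N.
  by rewrite mulnn -expnSr -!expnD; congr (d ^ _)%N; lia.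
have e12 : (1 * (d * d) * d)%N = (d * d * d)%N by rewrite mul1n.
have e23 : (d * (d * d) * 1)%N = (d * d * d)%N by rewrite muln1 mulnA.
exists e => D; split.
  rewrite (op12_embed e12); apply: embed_mx_comp; first by rewrite muln1.
  by rewrite -expnS; congr (d ^ _)%N; lia.
rewrite (op23_embed e23); apply: embed_mx_comp; first by rewrite -expnSr ij.
by rewrite mul1n ij.
Qed.

End LocalCopies.

End Embedding.

(** * Contraction along a rank-one operator *)

Section Sandwich.
Variables (C : numClosedFieldType) (d : nat) (psi : 'cV[C]_(d * d)).
Variables (x : C) (E : 'M[C]_(d * d)).
Hypotheses (x_neq0 : x != 0) (E_psi : E = x *: (psi *m psi^t*)).

(** With k = [ket12 psi], [op12 E] is x k k^*, so the product is x^2 k (k^* X k) k^* = x^2 (s / x) k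
    k^*. *)
Lemma op12_sandwich (s : C) (X : 'M[C]_(d * d * d)) :
  bra12 psi *m X *m ket12 psi = (s / x)%:M ->
  op12 E *m X *m op12 E = s *: op12 E.
Proof.
have -> : op12 E = x *: (ket12 psi *m bra12 psi).
  rewrite ket12_bra12 E_psi; move: (psi *m _) => P.
  by apply/matrixP => i j; rewrite !mxE mulrA.
move=> braXket; rewrite -!scalemxAl -!scalemxAr.
have -> (k : 'M_(_, d)) b : k *m b *m X *m (k *m b) = k *m (b *m X *m k) *m b.
  by rewrite !mulmxA.
rewrite braXket mul_mx_scalar -scalemxAl !scalerA; congr (_ *: _).
by rewrite -mulrA [x * (s / x)]mulrC divfK // mulrC.
Qed.

End Sandwich.

(** * Consequences of the cubic relation *)

Section Skein.
Variables (K : fieldType) (m : nat) (a q : K) (G : 'M[K]_m).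
Hypotheses (a_neq0 : a != 0) (q_neq0 : q != 0).
Hypothesis cubic : (G - a%:M) *m (G - q%:M) *m (G + q^-1%:M) = 0.

Lemma cubic_quadratic :
  (G - q%:M) *m (G + q^-1%:M) = G *m (G - (q - q^-1)%:M) - 1%:M.
Proof.
rewrite mulmxDr mul_mx_scalar mulmxBl mul_scalar_mx scalerBr scale_scalar_mx.
rewrite mulVf // mulmxBr mul_mx_scalar scalerBl opprB !addrA; congr (_ - _).
by rewrite addrAC.
Qed.

(** Write Q = G H - 1 for the quadratic factor. The cubic says G Q = a Q, whence G (H - a^-1 Q) = G
    H - Q = 1. *)
Lemma cubic_unitmx : G \in unitmx.
Proof.
set H := G - (q - q^-1)%:M.
have GX : G *m (H - a^-1 *: (G *m H - 1%:M)) = 1%:M.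
  have := cubic; rewrite -mulmxA cubic_quadratic -/H mulmxBl mul_scalar_mx.
  move=> /eqP; rewrite subr_eq0 => /eqP G_Q.
  by rewrite mulmxBr -scalemxAr G_Q scalerA mulVf // scale1r opprB addrC subrK.
by have [] := mulmx1_unit GX.
Qed.

(** The quadratic factor equals -(q - q^-1) G E, so the cubic becomes (G - a) G E = 0; the
    invertible G is then cancelled and E commutes with G. *)
Lemma skein_eigen (E := 1%:M - (q - q^-1)^-1 *: (G - invmx G)) :
  q - q^-1 != 0 -> E *m G = a *: E.
Proof.
move=> q0; have Gu := cubic_unitmx.
have comE : E *m G = G *m E.
  rewrite /E mulmxBl mulmxBr mul1mx mulmx1 -scalemxAl -scalemxAr.
  by rewrite mulmxBl mulmxBr mulmxV // mulVmx.
have quadE : (G - q%:M) *m (G + q^-1%:M) = (- (q - q^-1)) *: (G *m E).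
  rewrite cubic_quadratic /E [in RHS]mulmxBr mulmx1 -scalemxAr scalerBr scalerA.
  rewrite mulNr mulfV // scaleN1r opprK scaleNr [G *m (_ - invmx G)]mulmxBr.
  by rewrite mulmxV // mulmxBr mul_mx_scalar addrA [- _ + _]addrC.
have := cubic; rewrite -mulmxA quadE -scalemxAr => /eqP.
rewrite scaler_eq0 oppr_eq0 (negPf q0) /= mulmxBl mul_scalar_mx subr_eq0.
move=> /eqP GGE; rewrite comE -[LHS](mulKmx Gu) -[RHS](mulKmx Gu) GGE.
by rewrite scalemxAr.
Qed.

End Skein.

Theorem proposition11p2 (R : realType) (d : nat) (q r : R[i])
  (G : 'M[R[i]]_(d * d)) (psi : 'cV[R[i]]_(d * d))
  (x := (r - r^-1) / (q - q^-1) + 1)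
  (E := 1%:M - (q - q^-1)^-1 *: (G - invmx G))
  (q_neq0 : q != 0) (r_neq0 : r != 0) (q2_neq1 : q ^+ 2 != 1)
  (r_neq_q : r^-1 != q) (r_neq_Nq : r^-1 != - q^-1) (q_neq_Nq : q != - q^-1)
  (G_yang_baxter : yang_baxter G)
  (G_cubic : (G - r^-1%:M) *m (G - q%:M) *m (G + q^-1%:M) = 0)
  (x_neq0 : x != 0)
  (psi_unit : psi^t* *m psi = 1%:M)
  (E_psi : E = x *: (psi *m psi^t*))
  (contraction_G : bra12 psi *m op23 G *m ket12 psi = (r / x)%:M)
  (contraction_GV : bra12 psi *m invmx (op23 G) *m ket12 psi = (r^-1 / x)%:M)
  (n : nat) (n_ge2 : (2 <= n)%N) :
  exists rho : {rmorphism bmw n r q -> 'M[R[i]]_(d ^ n)},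
    [/\ scalable rho,
        forall i : 'I_n.-1, rho (bmw_g i) = local_copy G i
      & forall i : 'I_n.-1, rho (bmw_e i) = local_copy E i].
Proof.
have rV_neq0 : r^-1 != 0 by rewrite invr_eq0.
have q0 : q - q^-1 != 0.
  apply: contra q2_neq1; rewrite subr_eq0 => /eqP q_qV.
  by rewrite expr2 {1}q_qV mulVf.
have Gu : G \in unitmx := cubic_unitmx rV_neq0 q_neq0 G_cubic.
have EG : E *m G = r^-1 *: E := skein_eigen rV_neq0 q_neq0 G_cubic q0.
(* For d = 0 the squared norm of [psi] would be an empty sum, not 1. Positivity of d makes the
   matrix algebra nonzero. *)
have d_gt0 : (0 < d)%N.
  rewrite lt0n; apply/eqP => d0; have /matrixP/(_ 0 0) := psi_unit.
  rewrite !mxE big1 => [/eqP|[k k_lt] _]; first by rewrite eq_sym oner_eq0.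
  by exfalso; rewrite {2}d0 muln0 in k_lt.
have e23 : (d * (d * d) * 1)%N = (d * d * d)%N by rewrite muln1 mulnA.
(* The contraction hypothesis inverts on V^{\otimes 3}, while the local copies use the inverse taken
   on V^{\otimes 2}. *)
have op23V : invmx (op23 G) = op23 (invmx G).
  have GVG : op23 G *m op23 (invmx G) = 1%:M.
    by rewrite !(op23_embed e23) -embed_mxM mulmxV // embed_mx1.
  have [op23G_unit _] := mulmx1_unit GVG.
  by rewrite -[RHS](mulKmx op23G_unit) GVG mulmx1.
have local1 i : local_copy (n := n) 1%:M i = 1%:M :> 'M[R[i]]_(d ^ n).
  exact: embed_mx1.
have localB A B i :
    local_copy (n := n) (A - B) i =
    local_copy A i - local_copy B i :> 'M[R[i]]_(d ^ n).
  exact: embed_mxB.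
have localZ c A i :
    local_copy (n := n) (c *: A) i = c *: local_copy A i :> 'M[R[i]]_(d ^ n).
  exact: embed_mxZ.
have localE (i : 'I_n.-1) : local_copy E i =
    1%:M - (q - q^-1)^-1 *: (local_copy G i - local_copy (invmx G) i).
  by rewrite localB local1 localZ localB.
(* The side conditions follow in reverse order, from the contraction of G^-1 back to the positivity
   of the dimension. *)
have [||||||||||rho [rhoZ rho_g rho_e]] := @bmw_matrix_representation
    _ n (d ^ n) r q (local_copy G) (local_copy (invmx G)); last first.
- by exists rho; split=> // i; rewrite localE.
- move=> i j /(@local_copy_pair R[i] d)[e pair_e]; rewrite -localE.
  rewrite -!(pair_e _).1 -!(pair_e _).2 -!embed_mxM.
  rewrite (op12_sandwich x_neq0 E_psi (s := r^-1)) -?op23V //.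
  exact: embed_mxZ.
- move=> i j /(@local_copy_pair R[i] d)[e pair_e]; rewrite -localE.
  rewrite -!(pair_e _).1 -!(pair_e _).2 -!embed_mxM.
  rewrite (op12_sandwich x_neq0 E_psi (s := r)) //.
  exact: embed_mxZ.
- by move=> i; rewrite -localE -localZ -EG local_copyM.
- exact: local_copy_comm.
- move=> i j /(@local_copy_pair R[i] d)[e pair_e].
  by rewrite -!(pair_e _).1 -!(pair_e _).2 -!embed_mxM G_yang_baxter.
- by move=> i; rewrite -local_copyM mulVmx.
- by move=> i; rewrite -local_copyM mulmxV.
- by [].
- by [].
- by rewrite expn_gt0 d_gt0.
Qed.
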